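(* Let $G$ be an abelian group and let $H$ be a subgroup such that $G/H$ is finite. Equip $G$ with the coset-partition independence structure $\mathcal{I}_H$. If $G/H$ is nontrivial, then $$\mu(G)=\min\bigl\{|Q|:Q\text{ is a nontrivial subgroup of }G/H\bigr\},$$ so that $\mu(G)$ is the smallest prime divisor of $|G/H|$. If instead $G=H$, then $\mu(G)=\infty$. Moreover, $G$ has the matching property if and only if $G/H$ is trivial or has prime order.
   Context: A finitary matroid is a pair $(E,\mathcal{I})$ consisting of a set $E$ and a nonempty collection $\mathcal{I}$ of subsets of $E$ (called the independent sets) such that: (I1) if $A\in\mathcal{I}$ and $B\subseteq A$ then $B\in\mathcal{I}$; (I2) if $A,B$ are finite elements of $\mathcal{I}$ with $|B|=|A|+1$, then there is $x\in B\setminus A$ with $\{x\}\cup A\in\mathcal{I}$; (I3) if $A\subseteq E$ and every finite subset of $A$ belongs to $\mathcal{I}$, then $A\in\mathcal{I}$. The collection $\mathcal{I}$ is called an independence structure on $E$. A basis of a subset $A\subseteq E$ is an inclusion-maximal independent subset of $A$; any two bases of $A$ have the same cardinality, and the rank $\rho(A)$ is that cardinal number; $A$ has finite rank, written $\rho(A)<\infty$, if $\rho(A)$ is a nonnegative integer. An element $x\in E$ depends on $A\subseteq E$ if either $x\in A$, or $x\notin A$ and $\{x\}\cup B\notin\mathcal{I}$ for some independent $B\subseteq A$. The closure is $\operatorname{cl}(A)=\{x\in E: x\text{ depends on }A\}$, and $A$ is a flat if $\operatorname{cl}(A)=A$. An independence group is a group $G$ (written multiplicatively, with identity $1$) together with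 an independence structure $\mathcal{I}$ on the set $G$ such that for every $g\in G$ and $A\subseteq G$ one has $gA\in\mathcal{I}$ if and only if $A\in\mathcal{I}$, where $gA=\{gx:x\in A\}$. A submonoid of $G$ is a subset containing $1$ and closed under multiplication. For a subgroup $H$ of a group $G$, the coset-partition structure $\mathcal{I}_H$ is the collection of all subsets $A\subseteq G$ with $|A\cap gH|\leq 1$ for all $g\in G$; it makes $G$ an independence group. The submonoid-rank threshold of an independence group $G$ is $$\mu(G)=\min\Bigl(\bigl\{\rho(M):M\text{ is a submonoid of }G\text{ and }1<\rho(M)<\infty\bigr\}\cup\{\infty\}\Bigr).$$ Let $A,B$ be subsets of $G$ with $\rho(A)=\rho(B)$ finite. $A$ is matched to $B$ if for every basis $\mathcal{A}$ of $A$ and every basis $\mathcal{B}$ of $B$ there exists a bijection $f:\mathcal{A}\to\mathcal{B}$ such that $af(a)\notin A$ for all $a\in\mathcal{A}$. The independence group $G$ has the matching property if for every pair $(A,B)$ of finite-rank flats of $G$ with $\rho(A)=\rho(B)$ and $1\notin B$, $A$ is matched to $B$. *)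

(* Defs.v *)
From mathcomp Require Import all_boot.
From mathcomp Require Import boolp classical_sets functions cardinality.

Set Implicit Arguments.
Unset Strict Implicit.
Unset Printing Implicit Defensive.

Local Open Scope classical_set_scope.
Local Open Scope card_scope.
Local Open Scope group_scope.

(* The minimum of S `|` {oo} in the extended natural numbers, encoded as
   [option nat] with [None] for oo. *)
Definition min_oo (S : set nat) : option nat :=
  match pselect (exists n, `[< S n >]) with
  | left ex => Some (ex_minn ex)
  | right _ => None
  end.

Definition transl (G : groupType) (g : G) (A : set G) : set G :=
  [set g * x | x in A].

Definition prod_set (G : groupType) (A B : set G) : set G :=
  [set a * b | a in A & b in B].

Definition inv_set (G : groupType) (A : set G) : set G := [set a^-1 | a in A].

Definition is_submonoid (G : groupType) (M : set G) : Prop :=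
  M 1 /\ forall x y, M x -> M y -> M (x * y).

Definition is_subgroup (G : groupType) (H : set G) : Prop :=
  [/\ H 1, forall x y, H x -> H y -> H (x * y) & forall x, H x -> H x^-1].

(* The underlying set of G / H. When H is normal, G / H is a group for the
   setwise product, with identity H and setwise inverses (see [prod_transl]
   and [inv_transl] below for the abelian case). *)
Definition quotient_set (G : groupType) (H : set G) : set (set G) :=
  [set transl g H | g in [set: G]].

Definition is_quotient_subgroup (G : groupType) (H : set G) (Q : set (set G)) :
    Prop :=
  [/\ Q `<=` quotient_set H, Q H,
      forall C D, Q C -> Q D -> Q (prod_set C D) &
      forall C, Q C -> Q (inv_set C)].

Definition nontrivial_quotient_subgroup_orders (G : groupType) (H : set G) :
    set nat :=
  [set n | exists Q : set (set G),
     [/\ is_quotient_subgroup H Q, Q <> [set H] & Q #= `I_n]].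

Record finitary_matroid (E : Type) := FinitaryMatroid {
  indep :> set E -> Prop;
  indep_nonempty : exists A, indep A;
  indep_sub : forall A B : set E, indep A -> B `<=` A -> indep B;
  indep_exchange : forall (A B : set E) (n : nat), indep A -> indep B ->
    A #= `I_n -> B #= `I_n.+1 ->
    exists2 x, (B `\` A) x & indep ([set x] `|` A);
  indep_finitary : forall A : set E,
    (forall F : set E, finite_set F -> F `<=` A -> indep F) -> indep A
}.

Section Matroid.
Variables (E : Type) (I : finitary_matroid E).
Implicit Types A B : set E.

Definition is_basis A B : Prop :=
  [/\ B `<=` A, I B &
      forall C : set E, C `<=` A -> I C -> B `<=` C -> C = B].

(* The rank is a cardinal, and cardinals are only available relationally;
   this reads "rho(A) = n", for a finite n. *)
Definition has_rank A (n : nat) : Prop := exists2 B, is_basis A B & B #= `I_n.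

Definition depends A (x : E) : Prop :=
  A x \/ ~ A x /\ exists B, [/\ B `<=` A, I B & ~ I ([set x] `|` B)].

Definition cl A : set E := [set x | depends A x].

Definition is_flat A : Prop := cl A = A.

End Matroid.

Record indep_group (G : groupType) := IndepGroup {
  indep_group_matroid :> finitary_matroid G;
  indep_transl : forall (g : G) (A : set G),
    indep_group_matroid (transl g A) <-> indep_group_matroid A
}.

Section IndepGroup.
Variables (G : groupType) (I : indep_group G).
Implicit Types A B M : set G.

Definition submonoid_rank_threshold : option nat :=
  min_oo [set n | exists M, [/\ is_submonoid M, has_rank I M n & (1 < n)%N]].

Definition matched A B : Prop :=
  forall A' B', is_basis I A A' -> is_basis I B B' ->
  exists2 f : G -> G, set_bij A' B' f & forall a, A' a -> ~ A (a * f a).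

Definition matching_property : Prop :=
  forall A B, is_flat I A -> is_flat I B ->
  (exists2 n, has_rank I A n & has_rank I B n) ->
  ~ B 1 -> matched A B.

End IndepGroup.

Definition coset_indep (G : groupType) (H : set G) : set (set G) :=
  [set A | forall g : G, is_subset1 (A `&` transl g H)].

Lemma prod_transl (G : groupType) (H : set G) (a b : G) :
  (forall x y : G, commute x y) -> is_subgroup H ->
  prod_set (transl a H) (transl b H) = transl (a * b) H.
Proof.
move=> abG [H1 HM _]; have E h k : (a * h) * (b * k) = (a * b) * (h * k).
  by rewrite -!mulgA; congr (_ * _); rewrite mulgA (abG h b) -mulgA.
apply/seteqP; split=> [_ [_ [h Hh <-] [_ [k Hk <-] <-]]|_ [h Hh <-]].
  by exists (h * k); [apply: HM | rewrite E].
exists (a * h); first by exists h.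
by exists (b * 1); [exists 1 | rewrite E mulg1].
Qed.

Lemma inv_transl (G : groupType) (H : set G) (a : G) :
  (forall x y : G, commute x y) -> is_subgroup H ->
  inv_set (transl a H) = transl a^-1 H.
Proof.
move=> abG [_ _ HV]; apply/seteqP; split=> [_ [_ [h Hh <-] <-]|_ [h Hh <-]].
  by exists h^-1; [apply: HV | rewrite invgM abG].
exists (a * h^-1); first by exists h^-1; [apply: HV|].
by rewrite invgM invgK abG.
Qed.

Section CosetPartition.
Variables (G : groupType) (H : set G) (sgH : is_subgroup H).

Lemma translP (g x : G) : transl g H x <-> H (g^-1 * x).
Proof.
split=> [[h Hh <-]|Hx]; first by rewrite mulKg.
by exists (g^-1 * x) => //; rewrite mulVKg.
Qed.

Lemma coset_indepP (A : set G) :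
  coset_indep H A <->
  forall x y, A x -> A y -> H (x^-1 * y) -> x = y.
Proof.
have [H1 HM HV] := sgH.
split=> [IA x y Ax Ay Hxy|IA g x y [Ax /translP Hx] [Ay /translP Hy]].
  by apply: (IA x); split=> //; apply/translP; rewrite ?mulVg.
apply: IA => //; have := HM _ _ (HV _ Hx) Hy.
by rewrite invgM invgK -mulgA mulVKg.
Qed.

Lemma coset_indep_nonempty : coset_indep H !=set0.
Proof. by exists set0 => g x y []. Qed.

Lemma coset_indep_sub (A B : set G) :
  coset_indep H A -> B `<=` A -> coset_indep H B.
Proof.
by move=> IA BA g x y [/BA Ax gx] [/BA Ay gy]; apply: (IA g).
Qed.

Lemma coset_indep_exchange (A B : set G) (n : nat) :
  coset_indep H A -> coset_indep H B -> A #= `I_n -> B #= `I_n.+1 ->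
  exists2 x, (B `\` A) x & coset_indep H ([set x] `|` A).
Proof.
have [H1 HM HV] := sgH.
move=> /coset_indepP IA /coset_indepP IB An Bn.
have HC x y : H (x^-1 * y) -> H (y^-1 * x).
  by move=> /HV; rewrite invgM invgK.
apply: contrapT => noext.
have near b : exists a, B b -> A a /\ H (b^-1 * a).
  have [Bb|nBb] := pselect (B b); last by exists b => /nBb.
  have [Ab|nAb] := pselect (A b); first by exists b => _; rewrite mulVg.
  apply: contrapT => /forallNP far; apply: noext; exists b => //.
  apply/coset_indepP => x y [->|Ax] [->|Ay] // Hxy; last exact: IA.
  - by case: (far y) => _.
  - by case: (far x) => _; split=> //; apply: HC.
have [f fP] := choice near.
have : B #<= A.
  have finj : {in B &, injective f}.
    move=> x y; rewrite !inE => Bx By fxy; apply: IB => //.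
    have [_ Hx] := fP x Bx; have [_ /HC Hy] := fP y By.
    have := HM _ _ Hx Hy; by rewrite fxy -mulgA mulVKg.
  rewrite -(card_le_eql (inj_card_eq finj)).
  by apply: subset_card_le => _ [b Bb <-]; have [] := fP b Bb.
by rewrite (card_le_eql Bn) (card_le_eqr An) card_le_II ltnn.
Qed.

Lemma coset_indep_finitary (A : set G) :
  (forall F : set G, finite_set F -> F `<=` A -> coset_indep H F) ->
  coset_indep H A.
Proof.
move=> fA g x y [Ax gx] [Ay gy].
have xyA : [set x; y] `<=` A by move=> _ [->|->].
have fxy : finite_set [set x; y] by apply: finite_set2.
by apply: (fA _ fxy xyA g); split=> //; [left|right].
Qed.

Lemma coset_indep_transl (g : G) (A : set G) :
  coset_indep H (transl g A) <-> coset_indep H A.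
Proof.
have E x y : (g * x)^-1 * (g * y) = x^-1 * y by rewrite invgM -mulgA mulKg.
split=> /coset_indepP IA; apply/coset_indepP.
  move=> x y Ax Ay Hxy.
  by apply: (@mulgI _ g); apply: IA; [exists x|exists y|rewrite E].
move=> _ _ [x Ax <-] [y Ay <-]; rewrite E => Hxy.
by rewrite (IA x y).
Qed.

Definition coset_partition : indep_group G :=
  @IndepGroup G
    (FinitaryMatroid coset_indep_nonempty coset_indep_sub coset_indep_exchange
       coset_indep_finitary)
    coset_indep_transl.

End CosetPartition.

(* Main.v *)
From HB Require Import structures.
Require Import Defs.
From mathcomp Require Import boolp classical_sets functions cardinality.
From mathcomp Require Import all_boot fingroup cyclic pgroup.

Set Implicit Arguments.
Unset Strict Implicit.
Unset Printing Implicit Defensive.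

(** Everything is decided in the finite abelian group [G / H].  It is replaced
    by a [finGroupType] [gT] with a surjective morphism [phi : G -> gT] of
    kernel [H] ([finite_quotient]).  A set is independent exactly when [phi] is
    injective on it; so a basis of [A] is a set of representatives of the image
    [phi A], the rank of [A] is [#|phi A|] ([has_rankP]), and the flats are the
    full preimages of subsets of [gT] ([cl_fimg]).

    Threshold.  The image of a submonoid of [G] is a submonoid of a finite
    group, hence a subgroup, and every subgroup arises from its preimage.  So
    the ranks greater than 1 of submonoids are the orders of the nontrivial
    subgroups of [gT], which are also the orders of the nontrivial subgroups of
    [quotient_set H] ([submonoid_rank_orders], [quotient_subgroup_orders]).  By
    the theorems of Lagrange and Cauchy the least such order is the smallest
    prime divisor of [#|gT|] ([min_nontrivial_orders]).

    Matching, sufficiency.  Let [gT] have prime order, and let [X] and [Y] be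
    subsets of the same size, with 1 outside [Y].  By Hall's theorem
    ([hall_marriage]) it suffices that every nonempty [S] contained in [X] has
    at least [#|S|] neighbours, the neighbours of [x] being the [y] in [Y] with
    [x * y] outside [X].  If [V] is the set of the [y] in [Y] that are
    neighbours of no element of [S], then [S * (1 |: V)] is contained in [X],
    and [X] is not the whole group because [Y] is not; the Cauchy-Davenport
    inequality ([cauchy_davenport]) then gives [#|S| + #|V| <= #|X| = #|Y|],
    which is Hall's condition.

    Matching, necessity.  If [#|gT|] is neither 1 nor prime, there is a
    nontrivial proper subgroup [K], and some [g] outside [K].  Let [A] be the
    preimage of [K], and [B] that of [K] with 1 replaced by [g].  An element
    [b] of [B] over a nontrivial element of [K] can be matched with no [a] of
    [A], since [a * b] lies in [A] ([order_of_matching]). *)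

(** * Hall's marriage theorem *)

Section Hall.
Variables (T U : finType) (u0 : U).
Implicit Types (A S W : {set T}) (r : T -> {set U}).

(** Halmos and Vaughan's induction on [#|A|].  If some nonempty proper subset
    [S] is critical, i.e. has no more than [#|S|] neighbours, match [S] with its
    neighbours [N], and [A :\: S] outside [N].  If no subset is critical, any
    choice for one element [a] leaves Hall's condition true for the others.
    The default [u0] only serves to have a total function when [A] is empty. *)
Lemma hall_marriage A r :
  (forall S, S \subset A -> #|S| <= #|\bigcup_(x in S) r x|) ->
  exists f : T -> U,
    {in A &, injective f} /\ {in A, forall x, f x \in r x}.
Proof.
have [m] := ubnP #|A|; elim: m A r => // m IHm A r; rewrite ltnS => leAm hall.
have [->|[a Aa]] := set_0Vmem A.
  by exists (fun=> u0); split=> x; rewrite inE.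
have [/existsP[S /and3P[S0 prSA critS]]|/existsPn slack] :=
    boolP [exists S : {set T},
    [&& S != set0, S \proper A & #|\bigcup_(x in S) r x| <= #|S|]].
- have sSA := proper_sub prSA.
  have [f1 [inj1 f1r]] : exists f : T -> U,
      {in S &, injective f} /\ {in S, forall x, f x \in r x}.
    apply: IHm => [|W sWS]; last exact: hall (subset_trans sWS sSA).
    exact: leq_trans (proper_card prSA) leAm.
  set N := \bigcup_(x in S) r x in critS.
  have [f2 [inj2 f2r]] : exists f : T -> U, {in A :\: S &, injective f} /\
      {in A :\: S, forall x, f x \in r x :\: N}.
    apply: IHm => [|W].
      apply: leq_trans leAm; rewrite -(cardsID S A) (setIidPr sSA).
      by rewrite -[X in X < _]add0n ltn_add2r card_gt0.
    rewrite subsetD => /andP[sWA dWS].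
    (* Criticality of [S] makes Hall's condition for the union of [W] and [S]
       pass to [W] once the neighbours of [S] are removed. *)
    have := hall (W :|: S); rewrite subUset sWA sSA => /(_ isT).
    rewrite cardsU disjoint_setI0 // cards0 subn0 bigcup_setU -/N.
    rewrite -[X in _ <= X](cardsID N) setDUl setDv setU0 setIC setKU addnC.
    move=> hWS; rewrite -(leq_add2l #|S|) (leq_trans hWS) //.
    rewrite leq_add // subset_leq_card //; apply/subsetP=> u.
    rewrite inE => /andP[nNu /bigcupP[x Wx rxu]].
    by apply/bigcupP; exists x; rewrite // inE nNu.
  have disj x y : x \in S -> y \in A -> y \notin S -> f1 x <> f2 y.
    move=> Sx Ay nSy eq12; have /(f2r y) : y \in A :\: S by rewrite inE nSy.
    rewrite -eq12 inE => /andP[/negP[]].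
    by apply/bigcupP; exists x; rewrite // f1r.
  exists (fun x => if x \in S then f1 x else f2 x); split=> [x y Ax Ay|x Ax].
    case: ifPn => [Sx|nSx]; case: ifPn => [Sy|nSy].
    + exact: inj1.
    + by move/disj => /(_ Sx Ay nSy).
    + by move/esym/disj => /(_ Sy Ax nSx).
    + by apply: inj2; rewrite inE ?nSx ?nSy.
  case: ifPn => [/f1r//|nSx].
  have /f2r : x \in A :\: S by rewrite inE nSx.
  by rewrite inE => /andP[].
- have /card_gt0P[u rau] : 0 < #|r a|.
    by have := hall [set a]; rewrite sub1set big_set1 cards1 => /(_ Aa).
  have [f [injf fr]] : exists f : T -> U, {in A :\ a &, injective f} /\
      {in A :\ a, forall x, f x \in r x :\ u}.
    apply: IHm => [|W sWAa]; first by rewrite [#|A|](cardsD1 a) Aa in leAm.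
    have [->|W0] := eqVneq W set0; first by rewrite cards0.
    have prWA : W \proper A := sub_proper_trans sWAa (properD1 Aa).
    have := slack W; rewrite W0 prWA /= -ltnNge => ltW.
    rewrite -ltnS (leq_trans ltW) //.
    rewrite (cardsD1 u) -add1n leq_add ?leq_b1 // subset_leq_card //.
    apply/subsetP=> v; rewrite !inE => /andP[nvu /bigcupP[x Wx rxv]].
    by apply/bigcupP; exists x; rewrite // !inE nvu.
  have fNu x : x \in A -> x != a -> f x \in r x /\ f x != u.
    move=> Ax nxa; have /fr : x \in A :\ a by rewrite !inE nxa.
    by rewrite !inE => /andP[].
  exists (fun x => if x == a then u else f x); split=> [x y Ax Ay|x Ax].
    case: eqVneq => [->|nxa]; case: eqVneq => [-> //|nya].
    + by move=> eqf; have [_] := fNu y Ay nya; rewrite -eqf eqxx.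
    + by move=> eqf; have [_] := fNu x Ax nxa; rewrite eqf eqxx.
    + by apply: injf; rewrite !inE ?nxa ?nya.
  by case: eqVneq => [->//|nxa]; have [] := fNu x Ax nxa.
Qed.
End Hall.

(** * Matchings in groups of prime order *)

Section PrimeOrder.
Variable gT : finGroupType.
Hypotheses (abG : forall x y : gT, commute x y) (prG : prime #|gT|).
Implicit Types (A B S T V X Y : {set gT}).
Local Open Scope group_scope.

(** A nontrivial element of [T] generates the group, whose order is prime, and
    right multiplication by it preserves [S]. *)
Lemma mul_stable_full S T :
  S != set0 -> 1 \in T -> T != [set 1] -> S * T \subset S -> S = [set: gT].
Proof.
case/set0Pn=> s Ss T1 T1' sSTS.
have [t Tt nt1] : exists2 t, t \in T & t != 1.
  apply/exists_inP; apply: contraR T1' => /exists_inPn T1'.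
  rewrite eqEsubset sub1set T1 andbT; apply/subsetP=> t /T1'.
  by rewrite negbK inE.
have genT : <[t]> = [set: gT].
  apply/eqP; rewrite eqEcard subsetT cardsT.
  have := order_dvdG (in_setT t); rewrite cardsT.
  by case/primeP: prG => _ prG' /prG'; rewrite order_eq1 (negPf nt1) orderE /= => /eqP->.
apply/eqP; rewrite eqEsubset subsetT; apply/subsetP=> x _.
have: s^-1 * x \in <[t]> by rewrite genT inE.
case/cycleP=> i sx; rewrite -(mulKVg s x) sx.
elim: i {sx} => [|i IHi]; first by rewrite mulg1.
by rewrite expgSr mulgA; apply/(subsetP sSTS)/mem_mulg.
Qed.

(** The Cauchy-Davenport inequality in the form that Hall's condition calls
    for.  The proof is by Dyson's e-transform: for [s] in [S], replacing [S] by
    its union with [s *: T] and [T] by its intersection with [s^-1 *: S]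
    preserves [#|S| + #|T|] and keeps the product inside [A].  Unless [S] is
    stable under [T], some [s] makes [T] smaller, whence an induction on
    [#|T|]. *)
Lemma cauchy_davenport A S T :
  S != set0 -> 1 \in T -> S * T \subset A -> A != [set: gT] ->
  (#|S| + #|T| <= #|A|.+1)%N.
Proof.
have [m] := ubnP #|T|; elim: m S T => // m IHm S T; rewrite ltnS => leTm S0 T1 sSTA nA.
have sSA : S \subset A.
  by apply: subset_trans sSTA; rewrite -{1}(mulg1 S) mulgS ?sub1set.
have [->|T1'] := eqVneq T [set 1].
  by rewrite cards1 addn1 ltnS subset_leq_card.
have [sSTS|] := boolP (S * T \subset S).
  rewrite (mul_stable_full S0 T1 T1' sSTS) in sSA.
  by rewrite -subTset sSA in nA.
case/subsetPn=> _ /mulsgP[s t Ss Tt ->] nSst.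
have cardE : #|S :|: s *: T| + #|T :&: s^-1 *: S| = #|S| + #|T|.
  have -> : #|T :&: s^-1 *: S| = #|S :&: s *: T|.
    rewrite -(card_lcoset (T :&: _) s); congr #|pred_of_set _|; apply/setP=> x.
    by rewrite !(inE, mem_lcoset) invgK mulKVg andbC.
  by rewrite cardsUI card_lcoset.
rewrite -cardE; apply: IHm => //.
- apply: leq_trans leTm; apply: proper_card.
  rewrite properE subsetIl; apply/subsetPn; exists t => //.
  by rewrite inE Tt mem_lcoset invgK.
- by apply/set0Pn; exists s; rewrite inE Ss.
- by rewrite inE T1 mem_lcoset invgK mulg1.
apply/subsetP=> _ /mulsgP[x y Sx /setIP[Ty Ssy] ->]; rewrite mem_lcoset invgK in Ssy.
(* Commutativity is what keeps the product of [s *: T] and [s^-1 *: S] inside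
   [S * T]. *)
case/setUP: Sx Ssy => [Sx _|/lcosetP[t' Tt' ->] Ssy].
  by apply: (subsetP sSTA); apply: mem_mulg.
rewrite -mulgA (abG t') mulgA.
by apply: (subsetP sSTA); apply: mem_mulg.
Qed.

Lemma prime_order_matching X Y :
  #|X| = #|Y| -> 1 \notin Y ->
  exists f : gT -> gT,
    [/\ {in X &, injective f}, {in X, forall x, f x \in Y} &
        {in X, forall x, x * f x \notin X}].
Proof.
move=> cardXY Y1.
pose r x := [set y in Y | x * y \notin X].
have [S sSX|f [injf fr]] := hall_marriage (1 : gT) (A := X) (r := r).
  have [->|S0] := eqVneq S set0; first by rewrite cards0.
  set N := \bigcup_(x in S) r x; set V := Y :\: N.
  have sNY : N \subset Y.
    by apply/bigcupsP=> x _; apply/subsetP=> y; rewrite inE => /andP[].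
  have sSVX : S * (1 |: V) \subset X.
    apply/subsetP=> _ /mulsgP[x y Sx Vy ->].
    case/setU1P: Vy => [->|/setDP[Yy nNy]]; first by rewrite mulg1 (subsetP sSX).
    by apply: contraR nNy => nXxy; apply/bigcupP; exists x; rewrite // inE Yy.
  have nX : X != [set: gT].
    apply: contraNneq Y1 => XT; suff -> : Y = [set: gT] by rewrite inE.
    by apply/eqP; rewrite eqEcard subsetT -cardXY XT leqnn.
  have := cauchy_davenport S0 (setU11 1 V) sSVX nX.
  rewrite cardsU1 inE (negPf Y1) andbF /= addnCA ltnS cardXY.
  by rewrite -(cardsID N Y) (setIidPr sNY) leq_add2r.
exists f; split=> // x /fr; rewrite inE => /andP[] //.
Qed.

End PrimeOrder.

(** * Minimal orders of nontrivial subgroups *)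

Section MinOo.
Local Open Scope classical_set_scope.

Lemma min_oo_some (S : set nat) m :
  S m -> (forall k, S k -> m <= k) -> min_oo S = Some m.
Proof.
move=> Sm mmin; rewrite /min_oo; case: pselect => [ex|]; last first.
  by case; exists m; apply/asboolP.
case: ex_minnP => k /asboolP Sk kmin; congr Some.
by apply/eqP; rewrite eqn_leq mmin // kmin //; apply/asboolP.
Qed.

Lemma min_oo_none (S : set nat) : (forall k, ~ S k) -> min_oo S = None.
Proof.
move=> S0; rewrite /min_oo; case: pselect => // ex.
by have [k /asboolP/S0] := ex.
Qed.

Definition nontrivial_orders (gT : finGroupType) : set nat :=
  [set k | exists2 K : {group gT}, #|K| = k & (1 < k)%N].

Lemma min_nontrivial_orders (gT : finGroupType) :
  (1 < #|gT|)%N -> min_oo (nontrivial_orders gT) = Some (pdiv #|gT|).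
Proof.
move=> gt1; apply: min_oo_some.
  have [|x _ ox] := Cauchy (G := [set: gT]) (pdiv_prime gt1).
    by rewrite cardsT pdiv_dvd.
  by exists (<[x]>)%G => //; rewrite prime_gt1 ?pdiv_prime.
move=> k [K cardK lt1k]; apply: pdiv_min_dvd => //.
by rewrite -cardK -cardsT; apply/cardSg/subsetT.
Qed.

End MinOo.

(** * The quotient as a finite group *)

Section FiniteQuotient.
Variables (G : groupType) (abG : forall x y : G, commute x y).
Variables (H : set G) (sgH : is_subgroup H).
Local Open Scope classical_set_scope.
Local Open Scope card_scope.
Local Open Scope group_scope.

Lemma transl_eq (x y : G) : transl x H = transl y H <-> H (x^-1 * y).
Proof.
have [H1 HM HV] := sgH; split=> [eqxy|Hxy].
  by apply/translP; rewrite eqxy; apply/translP; rewrite mulVg.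
have Hyx : H (y^-1 * x) by have := HV _ Hxy; rewrite invgM invgK.
apply/seteqP; split=> z /translP Hz; apply/translP.
  by have := HM _ _ Hyx Hz; rewrite -mulgA mulVKg.
by have := HM _ _ Hxy Hz; rewrite -mulgA mulVKg.
Qed.

(** The cosets of [H] are numbered by ['I_n], and the group law of the quotient
    is transported to these numbers through a section [r] of the numbering
    [phi]. *)
Lemma finite_quotient n : quotient_set H #= `I_n ->
  exists (gT : finGroupType) (phi : G -> gT),
    [/\ {morph phi : x y / x * y}, forall z, exists x, phi x = z,
        forall x y, phi x = phi y <-> H (x^-1 * y) & #|gT| = n].
Proof.
have [H1 HM HV] := sgH.
move=> /card_set_bijP[f [fI finj fsurj]].
have lt_f x : (f (transl x H) < n)%N by apply: fI; exists x.
pose phi x : 'I_n := Ordinal (lt_f x).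
have phiP x y : phi x = phi y <-> H (x^-1 * y).
  rewrite -transl_eq; split=> [[eqf]|eqt]; last by apply/val_inj; rewrite /= eqt.
  by apply: finj => //; rewrite in_setE; [exists x|exists y].
have onto z : exists x, phi x = z.
  have [|_ [x _ <-] fx] := fsurj z; first exact: ltn_ord.
  by exists x; apply/val_inj.
have [r rK] := choice onto.
pose mul i j := phi (r i * r j); pose inv i := phi (r i)^-1.
have phiM x y : phi (x * y) = mul (phi x) (phi y).
  apply/phiP; have /phiP Hx := esym (rK (phi x)).
  have /phiP Hy := esym (rK (phi y)); rewrite invgM mulgA.
  by rewrite -(mulgA y^-1) (abG y^-1) -mulgA; apply: HM.
have phiV x : phi x^-1 = inv (phi x).
  apply/phiP; rewrite invgK -abG -[x in _ * x]invgK -invgM.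
  by apply: HV; apply/phiP; rewrite rK.
have mulA : associative mul.
  move=> i j k; have [[x <-] [[y <-] [z <-]]] := (onto i, (onto j, onto k)).
  by rewrite -!phiM mulgA.
have mul1 : left_id (phi 1) mul.
  by move=> i; have [x <-] := onto i; rewrite -phiM mul1g.
have mulV : left_inverse (phi 1) inv mul.
  by move=> i; have [x <-] := onto i; rewrite -phiV -phiM mulVg.
pose gT : finGroupType :=
  HB.pack 'I_n (Finite_isGroup.Build 'I_n mulA mul1 mulV).
by exists gT, phi; split=> //; apply: card_ord.
Qed.

End FiniteQuotient.

(** * Ranks, flats and submonoids seen in the quotient *)

Section Transfer.
Variables (G : groupType) (H : set G) (sgH : is_subgroup H).
Variables (gT : finGroupType) (phi : G -> gT).
Local Open Scope classical_set_scope.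
Local Open Scope card_scope.
Local Open Scope group_scope.
Hypothesis phiM : {morph phi : x y / x * y}.
Hypothesis phi_onto : forall z, exists x, phi x = z.
Hypothesis phiP : forall x y, phi x = phi y <-> H (x^-1 * y).
Local Notation I := (coset_partition sgH).
Implicit Types (A B M : set G) (X : {set gT}) (K : {group gT}).

Definition fimg A : {set gT} :=
  [set z | `[< exists2 x, A x & phi x = z >]]%SET.
Definition fpre X : set G := [set x | phi x \in X].

Lemma fimgP A z : reflect (exists2 x, A x & phi x = z) (z \in fimg A).
Proof. by rewrite inE; apply: asboolP. Qed.

Lemma fimg_mem A x : A x -> phi x \in fimg A.
Proof. by move=> Ax; apply/fimgP; exists x. Qed.

Lemma fpreK : cancel fpre fimg.
Proof.
move=> X; apply/setP=> z; apply/fimgP/idP => [[x Xx <-] //|Xz].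
by have [x xz] := phi_onto z; exists x; rewrite // /fpre /= xz.
Qed.

Lemma phi1 : phi 1 = 1.
Proof. by apply: (@mulgI _ (phi 1)); rewrite -phiM !mulg1. Qed.

Lemma phiV x : phi x^-1 = (phi x)^-1.
Proof. by apply: (@mulgI _ (phi x)); rewrite -phiM !mulgV phi1. Qed.

Lemma indep_injP A :
  I A <-> forall x y, A x -> A y -> phi x = phi y -> x = y.
Proof.
by split=> [/(coset_indepP sgH) IA x y Ax Ay /phiP|IA];
  [exact: IA | apply/(coset_indepP sgH) => x y Ax Ay /phiP; exact: IA].
Qed.

(** Maximality of an independent subset of [A] means that no coset meeting [A]
    is missed. *)
Lemma basis_fimgP A B :
  is_basis I A B <-> [/\ B `<=` A, I B & fimg B = fimg A].
Proof.
split=> [[sBA IB maxB]|[sBA IB eqBA]].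
  split=> //; apply/setP=> t; apply/fimgP/fimgP => -[x].
    by move=> /sBA; exists x.
  move=> Ax <- {t}; apply: contrapT => Bx; apply: (Bx); exists x => //.
  rewrite -(maxB ([set x] `|` B)); first by left.
  - by move=> y [->|/sBA].
  - apply/indep_injP => y z [->|By] [->|Bz] // eqyz.
    + by case: Bx; exists z.
    + by case: Bx; exists y.
    + by move/indep_injP: IB; apply.
  - by move=> y By; right.
split=> // C sCA IC sBC; apply/seteqP; split=> // x Cx.
have /fimgP[b Bb eqbx] : phi x \in fimg B by rewrite eqBA fimg_mem //; apply: sCA.
by move/indep_injP: IC => /(_ _ _ (sBC _ Bb) Cx eqbx) <-.
Qed.

(** Representatives in [A] of the cosets that meet [A]: they provide bases, and
    later lift matchings from the quotient. *)
Lemma fimg_section A :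
  exists s : gT -> G, forall z, z \in fimg A -> A (s z) /\ phi (s z) = z.
Proof.
suff /choice[s sP] : forall z, exists x, z \in fimg A -> A x /\ phi x = z.
  by exists s.
move=> z; have [/fimgP[x Ax xz]|] := boolP (z \in fimg A); first by exists x.
by exists 1.
Qed.

Lemma basis_exists A : exists B, is_basis I A B.
Proof.
have [s sP] := fimg_section A.
exists [set s z | z in [set z | z \in fimg A]]; apply/basis_fimgP; split.
- by move=> _ [z /sP[Asz _] <-].
- apply/indep_injP => _ _ [y Ay <-] [z Az <-].
  by have [_ ->] := sP y Ay; have [_ ->] := sP z Az => ->.
- apply/setP=> z; apply/fimgP/idP => [[_ [y /[dup] Ay /sP[_ sy] <-]]|Az].
    by rewrite sy => <-.
  by exists (s z); [exists z | have [] := sP z Az].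
Qed.

Lemma card_eq_finset (T : finType) (X : {set T}) :
  [set x | x \in X] #= `I_#|X|.
Proof.
have -> : [set x | x \in X] = (@enum_val T (mem X)) @` [set: 'I_#|X|].
  apply/seteqP; split=> [x Xx|_ [i _ <-]]; last exact: enum_valP.
  by exists (enum_rank_in Xx x); rewrite // enum_rankK_in.
apply: card_eq_trans (card_esym card_II).
by apply: inj_card_eq => i j _ _; apply: enum_val_inj.
Qed.

Lemma card_indep A : I A -> A #= `I_#|fimg A|.
Proof.
move/indep_injP=> IA; apply: card_eq_trans (card_eq_finset _).
have -> : [set z | z \in fimg A] = phi @` A.
  by apply/seteqP; split=> z /= /fimgP.
apply: card_esym; apply: inj_card_eq => x y; rewrite !in_setE; exact: IA.
Qed.

Lemma has_rankP A k : has_rank I A k <-> #|fimg A| = k.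
Proof.
split=> [[B /basis_fimgP[_ IB <-] cardB]|<-].
  by apply/card_eq_II; rewrite -(card_eql (card_indep IB)).
have [B basB] := basis_exists A; exists B => //.
by have /basis_fimgP[_ IB <-] := basB; apply: card_indep.
Qed.

(** The closure of [A] is the union of the cosets that meet [A]. *)
Lemma cl_fimg A : cl I A = fpre (fimg A).
Proof.
apply/seteqP; split=> [x [/fimg_mem //|[nAx [B [sBA IB dep]]]]|x].
  rewrite /fpre /=; apply: contrapT => nx; apply: dep.
  apply/indep_injP => y z [->|By] [->|Bz] // eqyz.
  - by case: nx; rewrite eqyz; apply/fimg_mem/sBA.
  - by case: nx; rewrite -eqyz; apply/fimg_mem/sBA.
  - by move/indep_injP: IB; apply.
rewrite /fpre /= => /fimgP[a Aa eqax].
have [Ax|nAx] := pselect (A x); [by left | right; split=> //].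
(* The witness of dependence is one point [a] of [A] in the coset of [x]. *)
exists [set a]; split=> [_ -> // | | /indep_injP dep].
  by apply/indep_injP => _ _ -> ->.
by apply: nAx; rewrite -(dep a x) //; [right|left].
Qed.

Lemma flat_fpre X : is_flat I (fpre X).
Proof. by rewrite /is_flat cl_fimg fpreK. Qed.

Lemma flat_mem A x : is_flat I A -> phi x \in fimg A -> A x.
Proof. by move=> flA Ax; rewrite -[A]flA cl_fimg. Qed.

(** In a finite group, closure under products suffices to be a subgroup. *)
Lemma submonoid_fimg M : is_submonoid M -> group_set (fimg M).
Proof.
case=> M1 MM; apply/group_setP; split; first by rewrite -phi1 fimg_mem.
move=> _ _ /fimgP[x Mx <-] /fimgP[y My <-].
by rewrite -phiM; apply/fimg_mem/MM.
Qed.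

Lemma submonoid_rank_orders :
  [set k | exists M, [/\ is_submonoid M, has_rank I M k & (1 < k)%N]] =
  nontrivial_orders gT.
Proof.
apply/seteqP; split=> k.
  case=> M [sM /has_rankP rM lt1k].
  by exists (group (submonoid_fimg sM)).
case=> K cardK lt1k; exists (fpre K); split=> //.
  by split=> [|x y]; rewrite /fpre /= ?phi1 ?group1 // phiM; apply: groupM.
by apply/has_rankP; rewrite fpreK.
Qed.

(** The coset of [H] that the element [z] of [gT] stands for. *)
Definition fiber (z : gT) : set G := [set x | phi x = z].

Lemma fiber_transl x : fiber (phi x) = transl x H.
Proof.
apply/seteqP; split=> y; first by move=> /esym/phiP /translP.
by move=> /translP /phiP /esym.
Qed.

Lemma fiber1 : fiber 1 = H.
Proof.
by rewrite -phi1 fiber_transl; apply/seteqP; split=> x;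
  rewrite translP invg1 mul1g.
Qed.

Lemma fiber_inj : injective fiber.
Proof.
move=> y z; have [x <-] := phi_onto y => eqyz.
by have : fiber (phi x) x by []; rewrite eqyz.
Qed.

Lemma prod_fiber y z : prod_set (fiber y) (fiber z) = fiber (y * z).
Proof.
apply/seteqP; split=> [_ [a <- [b <- <-]]|x xyz]; first exact: phiM.
have [a ay] := phi_onto y; exists a => //; exists (a^-1 * x).
  by rewrite /fiber /= phiM phiV ay xyz mulKg.
by rewrite mulVKg.
Qed.

Lemma inv_fiber z : inv_set (fiber z) = fiber z^-1.
Proof.
apply/seteqP; split=> [_ [a <- <-]|x xz]; first exact: phiV.
by exists x^-1; rewrite ?invgK // /fiber /= phiV xz invgK.
Qed.

Lemma quotient_set_fiber C : quotient_set H C <-> exists z, fiber z = C.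
Proof.
split=> [[x _ <-]|[z <-]]; first by exists (phi x); rewrite fiber_transl.
by have [x <-] := phi_onto z; exists x; rewrite // fiber_transl.
Qed.

Lemma card_fibers X : fiber @` [set z | z \in X] #= `I_#|X|.
Proof.
apply: card_eq_trans (card_eq_finset X).
by apply: inj_card_eq => y z _ _; apply: fiber_inj.
Qed.

(** [fiber] is an isomorphism from [gT] to [quotient_set H] with setwise
    operations, so it identifies the subgroups on both sides. *)
Lemma quotient_subgroup_orders :
  nontrivial_quotient_subgroup_orders H = nontrivial_orders gT.
Proof.
apply/seteqP; split=> k.
  case=> Q [[sQ QH QM QV] ntQ cardQ].
  pose X : {set gT} := [set z | `[< Q (fiber z) >]]%SET.
  have memX z : (z \in X) <-> Q (fiber z) by rewrite inE; split=> /asboolP.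
  have gX : group_set X.
    apply/group_setP; split; first by apply/memX; rewrite fiber1.
    by move=> y z /memX Qy /memX Qz; apply/memX; rewrite -prod_fiber; apply: QM.
  have QE : Q = fiber @` [set z | z \in X].
    apply/seteqP; split=> [C QC|_ [z /memX Qz <-] //].
    by have /quotient_set_fiber[z zC] := sQ _ QC; exists z => //;
      apply/memX; rewrite zC.
  have cardX : #|X| = k.
    by apply/card_eq_II; rewrite -(card_eql (card_fibers X)) -QE.
  exists (group gX) => //; rewrite -cardX ltnNge; apply/negP => leX1; apply: ntQ.
  have X1 : X = 1%g.
    apply/eqP; rewrite eq_sym eqEcard cards1 leX1 andbT sub1set.
    by apply/memX; rewrite fiber1.
  rewrite QE X1; apply/seteqP; split=> [_ [z /set1P -> <-]|_ ->].
    by rewrite fiber1.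
  by exists 1; rewrite ?fiber1 //= set11.
case=> K cardK lt1k; exists (fiber @` [set z | z \in K]).
split; last by rewrite -cardK; apply: card_fibers.
  split.
  - by move=> _ [z _ <-]; apply/quotient_set_fiber; exists z.
  - by exists 1; rewrite ?fiber1 //=.
  - move=> _ _ [y Ky <-] [z Kz <-]; rewrite prod_fiber; exists (y * z) => //.
    exact: groupM.
  - by move=> _ [z Kz <-]; rewrite inv_fiber; exists z^-1 => //=; rewrite groupV.
move=> eqQ; move: lt1k; rewrite -cardK ltnNge => /negP[].
rewrite -(cards1 (1 : gT)) subset_leq_card //; apply/subsetP=> z Kz.
have : [set H] (fiber z) by rewrite -eqQ; exists z.
by rewrite -{1}fiber1 => /fiber_inj ->; rewrite set11.
Qed.

Lemma quotient_set_trivial : quotient_set H = [set H] <-> #|gT| = 1%N.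
Proof.
split=> [QH|cT].
  rewrite -cardsT; apply/eqP/cards1P; exists 1; apply/setP=> z; rewrite !inE.
  apply/esym/eqP/fiber_inj; rewrite fiber1.
  by have /quotient_set_fiber : exists y, fiber y = fiber z by [exists z];
    rewrite QH.
have /fintype_le1P z1 : (#|gT| <= 1)%N by rewrite cT.
apply/seteqP; split=> [C /quotient_set_fiber[z <-]|_ ->].
  by rewrite (z1 1 z) fiber1.
by apply/quotient_set_fiber; exists 1; rewrite fiber1.
Qed.

(** * The matching property *)

(** A matching [f] of the images of [A] and [B] lifts to the bases: [a] is sent
    to the representative in [B'] of [f (phi a)], and membership in the flat [A]
    is decided by [phi]. *)
Lemma matching_of_prime_order : (forall y z : gT, commute y z) ->
  prime #|gT| -> matching_property I.
Proof.
move=> abT prT A B flA flB [k /has_rankP rA /has_rankP rB] nB1 A' B'.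
move=> /basis_fimgP[sA IA eqA] /basis_fimgP[sB IB eqB].
have [||f [injf fB fA]] := prime_order_matching abT prT
  (X := fimg A) (Y := fimg B).
- by rewrite rA rB.
- by apply/negP=> B1; apply: nB1; apply: flat_mem; rewrite ?phi1.
have [s sP] := fimg_section B'; rewrite eqB in sP.
have memA a : A' a -> phi a \in fimg A by move=> A'a; apply/fimg_mem/sA.
exists (fun a => s (f (phi a))) => [|a A'a].
  split=> [a A'a|a b|b B'b].
  - by have [] := sP _ (fB _ (memA _ A'a)).
  - rewrite !in_setE => A'a A'b eqs.
    have [_ sa] := sP _ (fB _ (memA _ A'a)).
    have [_ sb] := sP _ (fB _ (memA _ A'b)).
    move/indep_injP: IA; apply=> //; apply: injf; rewrite ?memA //.
    by rewrite -sa eqs.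
  have fAB : f @: fimg A = fimg B.
    apply/eqP; rewrite eqEcard card_in_imset // rA rB leqnn andbT.
    by apply/subsetP=> _ /imsetP[z Az ->]; apply: fB.
  have : phi b \in fimg B by apply/fimg_mem/sB.
  rewrite -fAB => /imsetP[z]; rewrite -{1}eqA => /fimgP[a A'a <-] bfa.
  exists a => //; have [B's es] := sP _ (fB _ (memA _ A'a)).
  by move/indep_injP: IB; apply=> //; rewrite es.
have [_ es] := sP _ (fB _ (memA _ A'a)).
by move/fimg_mem; rewrite phiM es; apply/negP/fA/memA.
Qed.

(** Here the only nonempty flat contains 1, so [B], and then [A], are empty. *)
Lemma matching_of_order1 : #|gT| = 1%N -> matching_property I.
Proof.
move=> cT A B flA flB [k /has_rankP rA /has_rankP rB] nB1 A' B'.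
have /fintype_le1P z1 : (#|gT| <= 1)%N by rewrite cT.
have nB b : ~ B b.
  move/fimg_mem => Bb; apply/nB1/(flat_mem flB).
  by rewrite phi1 -(z1 1 (phi b)).
have nA a : ~ A a.
  move/fimg_mem => Aa; have : (0 < #|fimg B|)%N.
    by rewrite rB -rA; apply/card_gt0P; exists (phi a).
  by case/card_gt0P => z /fimgP[b /nB].
move=> [sA _ _] [sB _ _]; exists id => [|a /sA/nA//].
by split=> [a /sA/nA|a b /[!in_setE] /sA/nA|b /sB/nB].
Qed.

(** The obstruction is the subgroup [K] of order [p], the smallest prime divisor
    of [#|gT|]: some basis element [b] of the preimage of [Y] lies over a
    nontrivial element of [K], so [A] is stable under multiplication by [b]. *)
Lemma order_of_matching :
  matching_property I -> #|gT| = 1%N \/ prime #|gT|.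
Proof.
move=> matchG; have [/eqP|nT1] := boolP (#|gT| == 1%N); [by left | right].
have gt1 : (1 < #|gT|)%N.
  by rewrite ltn_neqAle eq_sym nT1; apply/card_gt0P; exists 1.
apply: contraPP matchG => npr matchG.
have prp := pdiv_prime gt1; set p := pdiv _ in prp.
have ltp : (p < #|gT|)%N.
  rewrite ltn_neqAle pdiv_leq ?andbT 1?ltnW //.
  by apply: contra_notN npr => /eqP <-.
have [|x _ ox] := Cauchy (G := [set: gT]) prp; first by rewrite cardsT pdiv_dvd.
pose K := <[x]>%G; have cardK : #|K| = p by [].
have [g nKg] : exists g, g \notin K.
  apply/existsP; rewrite -negb_forall; apply: contraTN ltp => /forallP allK.
  by rewrite -leqNgt -cardK; apply/subset_leq_card/subsetP=> z _; apply: allK.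
pose Y := (g |: K^#)%SET.
have Y1 : 1 \notin Y.
  by rewrite !inE eqxx orbF; apply: contraNneq nKg => <-; apply: group1.
have cardY : #|Y| = p.
  by rewrite cardsU1 !inE (negPf nKg) andbF -cardK (cardsD1 1 K) group1.
have Kx : x \in K by apply: cycle_id.
have ntx : x != 1 by rewrite -order_eq1 ox; apply: contraTneq prp => ->.
have [A' basA] := basis_exists (fpre K); have [B' basB] := basis_exists (fpre Y).
have [||||f [fAB _ fsurj] fA] := matchG (fpre K) (fpre Y) _ _ _ _ A' B' basA basB.
- exact: flat_fpre.
- exact: flat_fpre.
- by exists p; apply/has_rankP; rewrite fpreK.
- by rewrite /fpre /= phi1; apply/negP.
have /basis_fimgP[_ _ eqB] := basB; have /basis_fimgP[sA _ _] := basA.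
have /fimgP[b B'b bx] : x \in fimg B' by rewrite eqB fpreK !inE ntx Kx orbT.
have [a A'a fab] := fsurj b B'b.
apply: (fA a A'a); rewrite /fpre /= phiM fab bx groupM //.
exact: sA A'a.
Qed.

End Transfer.

(** * The theorem *)

Local Open Scope classical_set_scope.
Local Open Scope card_scope.

Theorem proposition7p18 (G : groupType) (abG : forall x y : G, commute x y)
    (H : set G) (sgH : is_subgroup H)
    (n : nat) (cardGH : quotient_set H #= `I_n) :
  [/\ quotient_set H <> [set H] ->
        submonoid_rank_threshold (coset_partition sgH)
          = min_oo (nontrivial_quotient_subgroup_orders H)
        /\ submonoid_rank_threshold (coset_partition sgH) = Some (pdiv n),
      H = [set: G] ->
        submonoid_rank_threshold (coset_partition sgH) = None &
      matching_property (coset_partition sgH)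
        <-> (quotient_set H = [set H] \/ prime n)].
Proof.
have [gT [phi [phiM onto phiP cardT]]] := finite_quotient abG sgH cardGH.
have trivE := quotient_set_trivial phiM onto phiP.
rewrite /submonoid_rank_threshold (submonoid_rank_orders sgH phiM onto phiP).
rewrite (quotient_subgroup_orders phiM onto phiP).
split=> [ntH|HT|].
- split=> //; rewrite min_nontrivial_orders cardT // -cardT.
  rewrite ltn_neqAle eq_sym; apply/andP; split.
    by apply/eqP => /trivE.
  by apply/card_gt0P; exists 1%g.
- apply: min_oo_none => k [K cardK]; apply/negP; rewrite -leqNgt -cardK.
  rewrite -(cards1 (1%g : gT)) subset_leq_card //; apply/subsetP=> z _.
  have [x <-] := onto z; rewrite inE -(phi1 phiM); apply/eqP/phiP.
  by rewrite HT.
rewrite -cardT trivE; split; first exact: order_of_matching phiM onto phiP.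
case=> [|prT]; first exact: matching_of_order1 phiM phiP.
apply: (matching_of_prime_order phiM phiP) => // y z.
by have [[a <-] [b <-]] := (onto y, onto z); rewrite /commute -!phiM abG.
Qed.
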